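(* There exists a retraceable set $A$ such that no infinite subset $B\subseteq A$ is uniformly majorreducible.
   Context: An infinite set $A=\{a_0<a_1<\cdots\}$ is retraceable if there is a partial computable $\varphi$ with $\varphi(a_{n+1})=a_n$ for all $n$ and $\varphi(a_0)=a_0$. For an infinite set $B$ with principal function $p_B$ ($p_B(n)$ the $n$-th element of $B$ in increasing order), $B$ is uniformly majorreducible if there is a single Turing functional $\Phi$ with $\Phi^{f}=B$ for every function $f$ with $f(n)\ge p_B(n)$ for all $n$ (oracle the graph of $f$). *)

(* Defs.v *)
From HB Require Import structures.
From mathcomp Require Import all_boot.
From mathcomp Require Import boolp classical_sets cardinality.
From Stdlib Require Cantor.

Set Implicit Arguments.
Unset Strict Implicit.
Unset Printing Implicit Defensive.

Local Open Scope classical_set_scope.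

(* Kleene's mu-recursive functions relative to an oracle.  Codes carry no arity:
   [Zero], [Succ], [Proj] and [Oracle] read missing arguments as 0. *)
Inductive code : Type :=
| Zero
| Succ
| Proj of nat
| Oracle
| Comp of code & seq code
| PrimRec of code & code
| Mu of code.

(* [eval X c xs y]: with the set X as oracle, c on arguments xs halts with
   value y.  The oracle answers with the characteristic function of X. *)
Inductive eval (X : set nat) : code -> seq nat -> nat -> Prop :=
| eval_zero xs : eval X Zero xs 0
| eval_succ xs : eval X Succ xs (head 0 xs).+1
| eval_proj i xs : eval X (Proj i) xs (nth 0 xs i)
| eval_oracle xs : eval X Oracle xs (head 0 xs \in X)
| eval_comp f gs xs ys y :
    evals X gs xs ys -> eval X f ys y -> eval X (Comp f gs) xs y
| eval_rec0 f g xs y :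
    eval X f xs y -> eval X (PrimRec f g) (0 :: xs) y
| eval_recS f g n xs z y :
    eval X (PrimRec f g) (n :: xs) z -> eval X g [:: n, z & xs] y ->
    eval X (PrimRec f g) (n.+1 :: xs) y
(* z lists the (nonzero, minus one) values of f before its first zero y. *)
| eval_mu f xs y (z : nat -> nat) :
    (forall i, i < y -> eval X f (i :: xs) (z i).+1) ->
    eval X f (y :: xs) 0 -> eval X (Mu f) xs y
with evals (X : set nat) : seq code -> seq nat -> seq nat -> Prop :=
| evals_nil xs : evals X [::] xs [::]
| evals_cons g gs xs y ys :
    eval X g xs y -> evals X gs xs ys -> evals X (g :: gs) xs (y :: ys).

Fixpoint oracle_free (c : code) : bool :=
  match c with
  | Oracle => false
  | Comp f gs => oracle_free f && all oracle_free gs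
  | PrimRec f g => oracle_free f && oracle_free g
  | Mu f => oracle_free f
  | _ => true
  end.

(* The oracle [set0] is immaterial, as c never queries it. *)
Definition partial_computable (phi : nat -> option nat) : Prop :=
  exists2 c, oracle_free c &
    forall x y, phi x = Some y <-> eval set0 c [:: x] y.

(* The Turing functional with code c sends the oracle X to (the characteristic
   function of) the set B. *)
Definition functional_maps (c : code) (X B : set nat) : Prop :=
  forall x, eval X c [:: x] (x \in B).

Definition graph (f : nat -> nat) : set nat :=
  [set Cantor.to_nat (n, f n) | n in [set: nat]].

(* a is the principal function of A; it exists, and is then unique, exactly
   when A is infinite. *)
Definition principal_function (A : set nat) (a : nat -> nat) : Prop :=
  {homo a : m n / m < n} /\ range a = A.

Definition retraceable (A : set nat) : Prop :=
  exists2 a, principal_function A a &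
    exists phi, [/\ partial_computable phi,
                    forall n, phi (a n.+1) = Some (a n)
                  & phi (a 0) = Some (a 0)].

Definition uniformly_majorreducible (B : set nat) : Prop :=
  exists2 p, principal_function B p &
    exists Phi : code, forall f : nat -> nat,
      (forall n, p n <= f n) -> functional_maps Phi (graph f) B.

(* Main.v *)
Require Import Defs.
From HB Require Import structures.
From mathcomp Require Import all_boot.
From mathcomp Require Import boolp classical_sets cardinality.

(** A Turing functional [Phi] witnesses the uniform majorreducibility of at
    most one set: if it works for both [B] and [B'], run it on a common majorant
    of their principal functions.  As there are countably many functionals, only
    countably many sets are uniformly majorreducible.  On the other hand, the
    sets of (codes of) initial segments of [X : nat -> bool] are all retraced by
    one computable map, and an infinite subset of such a set determines [X].
    Hence some [X], obtained by diagonalization, is missed by every functional. *)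

Set Implicit Arguments.
Unset Strict Implicit.
Unset Printing Implicit Defensive.

Local Open Scope classical_set_scope.

(** Embedding [code] in [GenTree.tree nat] makes it countable; [pickle] then numbers the functionals
    for the diagonalization. *)
Fixpoint tree_of_code (c : code) : GenTree.tree nat :=
  match c with
  | Zero => GenTree.Node 0 [::]
  | Succ => GenTree.Node 1 [::]
  | Proj i => GenTree.Leaf i
  | Oracle => GenTree.Node 2 [::]
  | Comp f gs => GenTree.Node 3 (tree_of_code f :: map tree_of_code gs)
  | PrimRec f g => GenTree.Node 4 [:: tree_of_code f; tree_of_code g]
  | Mu f => GenTree.Node 5 [:: tree_of_code f]
  end.

Fixpoint code_of_tree (t : GenTree.tree nat) : code :=
  match t with
  | GenTree.Leaf i => Proj i
  | GenTree.Node 1 _ => Succ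
  | GenTree.Node 2 _ => Oracle
  | GenTree.Node 3 (t :: ts) => Comp (code_of_tree t) (map code_of_tree ts)
  | GenTree.Node 4 [:: t; u] => PrimRec (code_of_tree t) (code_of_tree u)
  | GenTree.Node 5 [:: t] => Mu (code_of_tree t)
  | _ => Zero
  end.

Lemma tree_of_codeK : cancel tree_of_code code_of_tree.
Proof.
(* The generated induction principle gives no hypothesis for the codes listed in [Comp], hence the
   raw fixpoint. *)
rewrite /cancel; fix IH 1; case=> //=.
- move=> f gs; congr Comp; first exact: IH.
  by elim: gs => //= g gs ->; rewrite IH.
- by move=> f g; rewrite !IH.
- by move=> f; rewrite IH.
Qed.

HB.instance Definition _ := Countable.copy code (can_type tree_of_codeK).

Scheme eval_mind := Minimality for eval Sort Prop
  with evals_mind := Minimality for evals Sort Prop.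

Lemma eval_MuP X f xs y : eval X (Mu f) xs y ->
  (forall i, i < y -> exists z, eval X f (i :: xs) z.+1) /\
  eval X f (y :: xs) 0.
Proof. by move=> e; inversion e; subst; split=> // i; eexists; eauto. Qed.

Lemma eval_functional (X : set nat) c xs y y' :
  eval X c xs y -> eval X c xs y' -> y = y'.
Proof.
move=> cy; move: y'; move: c xs y cy.
apply: (@eval_mind X (fun c xs y => forall y', eval X c xs y' -> y = y')
  (fun cs xs ys => forall ys', evals X cs xs ys' -> ys = ys')).
- by move=> xs y' e; inversion e.
- by move=> xs y' e; inversion e.
- by move=> i xs y' e; inversion e.
- by move=> xs y' e; inversion e.
- move=> f gs xs ys y _ IHgs _ IHf y' e; inversion e; subst.
  by apply: IHf; rewrite (IHgs ys0).
- by move=> f g xs y _ IHf y' e; inversion e; subst; apply: IHf.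
- move=> f g n xs z y _ IHn _ IHg y' e; inversion e; subst.
  by apply: IHg; rewrite (IHn z0).
- move=> f xs y z _ IHz _ IHy y' /eval_MuP[lt_nz fy'0].
  (* At the smaller of two distinct results, [f] would have both the value 0 and a successor
     value. *)
  case: (ltngtP y y') => // [lt_yy'|lt_y'y].
  + by have [z' /IHy] := lt_nz _ lt_yy'.
  + by have := IHz _ lt_y'y _ fy'0.
- by move=> xs ys' e; inversion e.
- move=> g gs xs y ys _ IHg _ IHgs ys' e; inversion e; subst.
  by rewrite (IHg y0) // (IHgs ys0).
Qed.

Lemma functional_maps_inj c X B B' :
  functional_maps c X B -> functional_maps c X B' -> B = B'.
Proof.
move=> cB cB'; apply/seteqP; split=> x; have := eval_functional (cB x) (cB' x).
  move=> eqx /mem_set Bx; apply/set_mem.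
  by move: eqx; rewrite Bx; case: (x \in B').
move=> eqx /mem_set Bx; apply/set_mem.
by move: eqx; rewrite Bx; case: (x \in B).
Qed.

Definition majorreduces (Phi : code) (B : set nat) : Prop :=
  exists2 p, principal_function B p &
    forall f : nat -> nat,
      (forall n, p n <= f n) -> functional_maps Phi (graph f) B.

Lemma majorreduces_inj Phi B B' :
  majorreduces Phi B -> majorreduces Phi B' -> B = B'.
Proof.
move=> [p _ PhiB] [p' _ PhiB'].
apply: (@functional_maps_inj Phi (graph (fun n => maxn (p n) (p' n)))).
  by apply: PhiB => n; apply: leq_maxl.
by apply: PhiB' => n; apply: leq_maxr.
Qed.

Definition pred_code : code := PrimRec Zero (Proj 0).

(** The subtrahend comes first, since [PrimRec] recurses on its first argument. *)
Definition subn_code : code := PrimRec (Proj 0) (Comp pred_code [:: Proj 1]).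

(* [n.+1./2 = n - n./2] *)
Definition half_code : code :=
  PrimRec Zero (Comp subn_code [:: Proj 1; Proj 0]).

Lemma eval_pred_code X n : eval X pred_code [:: n] n.-1.
Proof.
elim: n => [|n IHn]; first by apply: eval_rec0; apply: eval_zero.
by apply: (eval_recS IHn); apply: (eval_proj _ 0 [:: n; n.-1]).
Qed.

Lemma eval_subn_code X k n : eval X subn_code [:: k; n] (n - k).
Proof.
elim: k => [|k IHk].
  by rewrite subn0; apply: eval_rec0; apply: (eval_proj _ 0 [:: n]).
apply: (eval_recS IHk); rewrite subnS.
apply: eval_comp (eval_pred_code _ _).
apply: evals_cons (evals_nil _ _); exact: (eval_proj _ 1 [:: k; n - k; n]).
Qed.

Lemma eval_half_code X n : eval X half_code [:: n] n./2.
Proof.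
elim: n => [|n IHn]; first by apply: eval_rec0; apply: eval_zero.
apply: (eval_recS IHn).
have -> : n.+1./2 = n - n./2.
  rewrite -[n.+1./2]/(uphalf n) uphalf_half.
  by rewrite -{3}(odd_double_half n) -addnn addnA addnK.
apply: eval_comp (eval_subn_code _ _ _).
apply: evals_cons; first exact: (eval_proj _ 1 [:: n; n./2]).
apply: evals_cons (evals_nil _ _); exact: (eval_proj _ 0 [:: n; n./2]).
Qed.

Lemma partial_computable_half : partial_computable (fun n => Some n./2).
Proof.
exists half_code => // x y; split=> [[<-]|]; first exact: eval_half_code.
by move=> /(eval_functional (eval_half_code _ _)) ->.
Qed.

(* The binary number [X 0 ... X n.-1], most significant digit first; it
   determines the digits and their number [n] as soon as [X 0 = true]. *)
Fixpoint prefix_code (X : nat -> bool) (n : nat) : nat :=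
  if n is m.+1 then X m + (prefix_code X m).*2 else 0.

Lemma half_prefix_code X n : (prefix_code X n.+1)./2 = prefix_code X n.
Proof. exact: half_bit_double. Qed.

Lemma prefix_code_gt0 (X : nat -> bool) n : X 0 -> 0 < prefix_code X n.+1.
Proof.
move=> X0; elim: n => [|n IHn]; first by rewrite /= X0.
by rewrite [prefix_code _ _]/= addn_gt0 double_gt0 IHn orbT.
Qed.

(** A further digit at least doubles the number, which is positive from length 1 on because the
    leading digit is 1. *)
Lemma prefix_code_mono (X : nat -> bool) :
  X 0 -> {homo prefix_code X : m n / m < n}.
Proof.
move=> X0; apply: homo_ltn => [m n p|[|n]];
  [exact: ltn_trans|exact: prefix_code_gt0|].
have := prefix_code_gt0 n X0; set a := prefix_code X n.+1 => a0.
rewrite -[prefix_code X n.+2]/(X n.+1 + a.*2) -addnn addnA.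
by rewrite -[ltnLHS]add0n ltn_add2r addn_gt0 a0 orbT.
Qed.

(** Halving drops the last digit, and it fixes the least element 0, the code of the empty prefix. *)
Lemma retraceable_prefix_code (X : nat -> bool) :
  X 0 -> retraceable (range (prefix_code X)).
Proof.
move=> X0; exists (prefix_code X); first by split=> //; apply: prefix_code_mono.
exists (fun n => Some n./2); split=> //; first exact: partial_computable_half.
by move=> n; rewrite half_prefix_code.
Qed.

(** Halving peels off the last digits of both sides together. Neither side runs out first, as a
    nonempty prefix has a positive code; so the lengths agree, and parity compares the digits peeled
    off. *)
Lemma prefix_code_inj (X Y : nat -> bool) m n : X 0 -> Y 0 ->
  prefix_code X m = prefix_code Y n -> forall i, i < m -> X i = Y i.
Proof.
move=> X0 Y0; elim: m n => [|m IHm] [|n] // eqXY.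
  by have := prefix_code_gt0 m X0; rewrite eqXY.
have eqh : prefix_code X m = prefix_code Y n.
  by rewrite -half_prefix_code eqXY half_prefix_code.
have eq_mn : m = n.
  elim: m n eqh {IHm eqXY} => [|m IHm] [|n] // eqh.
  - by have := prefix_code_gt0 n Y0; rewrite -eqh.
  - by have := prefix_code_gt0 m X0; rewrite eqh.
  - by congr _.+1; apply: IHm; rewrite -half_prefix_code eqh half_prefix_code.
move=> i; rewrite ltnS leq_eqVlt => /predU1P[->|]; last exact: IHm eqh _.
have := congr1 odd eqXY; rewrite /= !oddD !odd_double !addbF !oddb.
by rewrite eq_mn.
Qed.

Lemma homo_ltn_geq_id p n : {homo p : m n / m < n} -> n <= p n.
Proof.
move=> p_mono; elim: n => // n IHn.
by apply: leq_ltn_trans IHn _; apply: p_mono.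
Qed.

(** For each [k], some element of [B] exceeds [prefix_code X k]. It codes a prefix longer than [k]
    of both sequences, so they agree at [k]. *)
Lemma range_prefix_code_inj (X Y : nat -> bool) (B : set nat) p :
  X 0 -> Y 0 -> principal_function B p -> B `<=` range (prefix_code X) ->
  B `<=` range (prefix_code Y) -> X =1 Y.
Proof.
move=> X0 Y0 [p_mono pB] BX BY k.
have Bx : B (p (prefix_code X k).+1) by rewrite -pB; exists (prefix_code X k).+1.
have [m _ eqm] := BX _ Bx; have [n _ eqn] := BY _ Bx.
apply: (@prefix_code_inj _ _ m n X0 Y0); first by rewrite eqm eqn.
have lt_km : prefix_code X k < prefix_code X m.
  by rewrite eqm; apply: homo_ltn_geq_id.
rewrite ltnNge; apply: contraTN lt_km => le_mk; rewrite -leqNgt.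
move: le_mk; rewrite leq_eqVlt => /predU1P[-> //|/(prefix_code_mono X0)].
exact: ltnW.
Qed.

Theorem theorem5p12 :
  exists A : set nat, retraceable A /\
    forall B : set nat, B `<=` A -> infinite_set B ->
      ~ uniformly_majorreducible B.
Proof.
pose P (Phi : code) (X : nat -> bool) := X 0 /\
  exists2 B, B `<=` range (prefix_code X) & majorreduces Phi B.
have P_unique Phi X Y : P Phi X -> P Phi Y -> X =1 Y.
  move=> [X0 [B BX PhiB]] [Y0 [B' B'Y PhiB']].
  move: B'Y; rewrite -(majorreduces_inj PhiB PhiB') => BY.
  by have [p Bp _] := PhiB; apply: range_prefix_code_inj Bp BX BY.
(* [Z Phi] is the only sequence that [X] must avoid on account of [Phi]; it is arbitrary if there is
   none. *)
have [Z ZP] : {Z : code -> nat -> bool & forall Phi X, P Phi X -> X =1 Z Phi}.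
  apply: (@choice _ _ (fun Phi Z => forall X, P Phi X -> X =1 Z)) => Phi.
  have [[Z PZ]|noZ] := pselect (exists Z, P Phi Z).
    by exists Z => X PX; apply: P_unique PX PZ.
  by exists xpredT => X PX; case: noZ; exists X.
(* Digit 0 is reserved for the leading 1, so the functional numbered [m] is defeated at digit
   [m.+1]; a number of no functional gets the default [true]. *)
pose X n := if n is m.+1 then
  if unpickle m is Some Phi then ~~ Z Phi n else true else true.
exists (range (prefix_code X)); split; first exact: retraceable_prefix_code.
move=> B BX _ [p Bp [Phi PhiB]].
have /ZP/(_ (pickle Phi).+1) : P Phi X by split=> //; exists B => //; exists p.
by rewrite /X pickleK; case: (Z _ _).
Qed.
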